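(* Let $\mathsf{C}$ be a Markov category that (1) has conditionals, (2) is a.s.-compatibly representable, and (3) has countable Kolmogorov powers. Let $A, X$ be objects of $\mathsf{C}$. Then a morphism $p \colon A \to X^{\mathbb{N}}$ in $\mathsf{C}$ is exchangeable if and only if there is a morphism $\mu \colon A \to PX$ in $\mathsf{C}$ such that $$p \;=\; \mathrm{samp}^{\mathbb{N}} \circ \mathrm{copy}^{\infty}_{PX} \circ \mu ,$$ where $PX$ is the distribution object of $X$, $\mathrm{samp} \colon PX \to X$ is the sampling map, $\mathrm{copy}^{\infty}_{PX} \colon PX \to (PX)^{\mathbb{N}}$ is the countable copy morphism, and $\mathrm{samp}^{\mathbb{N}} \colon (PX)^{\mathbb{N}} \to X^{\mathbb{N}}$ is the countable Kolmogorov power of $\mathrm{samp}$.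
   Context: Coherence isomorphisms of monoidal categories are suppressed. Markov category: a symmetric monoidal category $(\mathsf{C},\otimes,I)$ whose unit $I$ is terminal, in which every object $X$ is equipped with morphisms $\mathrm{copy}_X \colon X \to X\otimes X$ and $\mathrm{del}_X \colon X \to I$ making $X$ a commutative comonoid, and such that $\mathrm{copy}_{X\otimes Y} = (\mathrm{id}_X \otimes \mathrm{swap}_{X,Y} \otimes \mathrm{id}_Y)\circ(\mathrm{copy}_X\otimes \mathrm{copy}_Y)$ for all $X,Y$. Conditionals: $\mathsf{C}$ has conditionals if for all objects $A,X,Y$ and every $f \colon A \to X\otimes Y$ there is $f_{|X} \colon X\otimes A \to Y$ with $f = (\mathrm{id}_X \otimes f_{|X}) \circ (\mathrm{copy}_X\otimes \mathrm{id}_A)\circ (f_X \otimes \mathrm{id}_A)\circ \mathrm{copy}_A$, where $f_X = (\mathrm{id}_X\otimes \mathrm{del}_Y)\circ f$. Almost sure equality: for $m \colon \Theta \to A$ and $f,g \colon A \to X$, write $f =_{m\text{-a.s.}} g$ if $(\mathrm{id}_A\otimes f)\circ\mathrm{copy}_A\circ m = (\mathrm{id}_A\otimes g)\circ\mathrm{copy}_A\circ m$. Deterministic: $f \colon A \to X$ is deterministic if $(f\otimes f)\circ \mathrm{copy}_A = \mathrm{copy}_X\circ f$. $\mathsf{C}_{\det}$ is the subcategory of deterministic morphisms. Representability: a distribution object for $X$ is an object $PX$ with bijections $\mathsf{C}(A,X)\cong \mathsf{C}_{\det}(A,PX)$, $f\mapsto f^\sharp$, natural in $A$ (with respect to deterministic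 morphisms). $\mathsf{C}$ is representable if every object has a distribution object. It is a.s.-compatibly representable if moreover for all $m\colon\Theta\to A$ and $f,g\colon A\to X$: $f=_{m\text{-a.s.}} g \iff f^\sharp =_{m\text{-a.s.}} g^\sharp$. The sampling map $\mathrm{samp}\colon PX\to X$ is the morphism with $\mathrm{samp}^\sharp=\mathrm{id}_{PX}$. Countable Kolmogorov power: for finite $F'\subseteq F\subseteq\mathbb{N}$ let $\pi_{F,F'}\colon X^F\to X^{F'}$ be the morphism which is the identity on the factors in $F'$ and $\mathrm{del}_X$ on the others ($X^F$ is the $F$-indexed tensor power). A countable Kolmogorov power of $X$ is an object $X^{\mathbb{N}}$ with deterministic morphisms $\pi_F\colon X^{\mathbb{N}}\to X^F$ ($F\subseteq\mathbb{N}$ finite) such that, for all objects $A,Y$, the assignment $f\mapsto((\pi_F\otimes\mathrm{id}_Y)\circ f)_F$ is a bijection from $\mathsf{C}(A,X^{\mathbb{N}}\otimes Y)$ to families $(f_F\colon A\to X^F\otimes Y)_F$ with $f_{F'}=(\pi_{F,F'}\otimes\mathrm{id}_Y)\circ f_F$ whenever $F'\subseteq F$. $\mathsf{C}$ has countable Kolmogorov powers if every object has one. For $f\colon X\to Y$, $f^{\mathbb{N}}\colon X^{\mathbb{N}}\to Y^{\mathbb{N}}$ is the unique morphism with $\pi_F\circ f^{\mathbb{N}}=f^{F}\circ\pi_F$ for all finite $F$, where $f^F$ is the $F$-fold tensor power of $f$. The countable copy morphism $\mathrm{copy}^\infty_Z\colon Z\to Z^{\mathbb{N}}$ is the unique morphism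 such that $\pi_F\circ\mathrm{copy}^\infty_Z\colon Z\to Z^F$ is the $|F|$-fold iterated copy morphism for every finite $F$. For an injection $i\colon\mathbb{N}\to\mathbb{N}$, $X^i\colon X^{\mathbb{N}}\to X^{\mathbb{N}}$ is the unique morphism such that for each finite $F$, $\pi_F\circ X^i$ is $\pi_{i(F)}\colon X^{\mathbb{N}}\to X^{i(F)}$ followed by the canonical isomorphism $X^{i(F)}\cong X^F$ identifying factors along $i$. A finite permutation is a bijection $\sigma\colon\mathbb{N}\to\mathbb{N}$ fixing all but finitely many elements. A morphism $p\colon A\to X^{\mathbb{N}}$ is exchangeable if $X^\sigma\circ p=p$ for every finite permutation $\sigma$. *)

(* Defs.v *)
From mathcomp Require Import all_boot finmap.

Set Implicit Arguments.
Unset Strict Implicit.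
Unset Printing Implicit Defensive.

Declare Scope cat_scope.
Delimit Scope cat_scope with C.
Local Open Scope cat_scope.

(* * Symmetric monoidal categories *)

Record category := Category {
  obj :> Type;
  hom : obj -> obj -> Type;
  idm : forall X, hom X X;
  comp : forall X Y Z, hom Y Z -> hom X Y -> hom X Z;
  comp_idl : forall X Y (f : hom X Y), comp (idm Y) f = f;
  comp_idr : forall X Y (f : hom X Y), comp f (idm X) = f;
  compA : forall W X Y Z (h : hom Y Z) (g : hom X Y) (f : hom W X),
    comp h (comp g f) = comp (comp h g) f
}.
Arguments hom {c} X Y : rename.
Arguments idm {c} X : rename.
Arguments comp {c X Y Z} g f : rename.

Notation "X ~> Y" := (hom X Y) (at level 70, no associativity) : cat_scope.
Notation "g ∘ f" := (comp g f) (at level 50, left associativity) : cat_scope.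

(* The coherence isomorphisms, suppressed in informal notation, are explicit:
   no strictness is assumed. *)
Record symmonoidal := SymMonoidal {
  smc_category :> category;
  tens : smc_category -> smc_category -> smc_category;
  tunit : smc_category;
  tensm : forall X Y X' Y' : smc_category,
    X ~> X' -> Y ~> Y' -> tens X Y ~> tens X' Y';
  assoc : forall X Y Z, tens (tens X Y) Z ~> tens X (tens Y Z);
  associ : forall X Y Z, tens X (tens Y Z) ~> tens (tens X Y) Z;
  lunit : forall X, tens tunit X ~> X;
  luniti : forall X, X ~> tens tunit X;
  runit : forall X, tens X tunit ~> X;
  runiti : forall X, X ~> tens X tunit;
  swap : forall X Y, tens X Y ~> tens Y X;
  (* bifunctoriality *)
  tensm_id : forall X Y, tensm (idm X) (idm Y) = idm (tens X Y);
  tensm_comp : forall X Y X' Y' X'' Y'' (f' : X' ~> X'') (f : X ~> X')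
      (g' : Y' ~> Y'') (g : Y ~> Y'),
    tensm (f' ∘ f) (g' ∘ g) = tensm f' g' ∘ tensm f g;
  (* inverses *)
  assocK : forall X Y Z, associ X Y Z ∘ assoc X Y Z = idm _;
  associK : forall X Y Z, assoc X Y Z ∘ associ X Y Z = idm _;
  lunitK : forall X, luniti X ∘ lunit X = idm _;
  lunitiK : forall X, lunit X ∘ luniti X = idm _;
  runitK : forall X, runiti X ∘ runit X = idm _;
  runitiK : forall X, runit X ∘ runiti X = idm _;
  swapK : forall X Y, swap Y X ∘ swap X Y = idm _;
  (* naturality *)
  assoc_nat : forall X Y Z X' Y' Z' (f : X ~> X') (g : Y ~> Y') (h : Z ~> Z'),
    assoc X' Y' Z' ∘ tensm (tensm f g) h = tensm f (tensm g h) ∘ assoc X Y Z;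
  lunit_nat : forall X X' (f : X ~> X'),
    lunit X' ∘ tensm (idm tunit) f = f ∘ lunit X;
  runit_nat : forall X X' (f : X ~> X'),
    runit X' ∘ tensm f (idm tunit) = f ∘ runit X;
  swap_nat : forall X Y X' Y' (f : X ~> X') (g : Y ~> Y'),
    swap X' Y' ∘ tensm f g = tensm g f ∘ swap X Y;
  (* coherence *)
  pentagon : forall W X Y Z,
    assoc W X (tens Y Z) ∘ assoc (tens W X) Y Z =
    tensm (idm W) (assoc X Y Z) ∘ assoc W (tens X Y) Z
      ∘ tensm (assoc W X Y) (idm Z);
  triangle : forall X Y,
    tensm (idm X) (lunit Y) ∘ assoc X tunit Y = tensm (runit X) (idm Y);
  hexagon : forall X Y Z,
    assoc Y Z X ∘ swap X (tens Y Z) ∘ assoc X Y Z =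
    tensm (idm Y) (swap X Z) ∘ assoc Y X Z ∘ tensm (swap X Y) (idm Z)
}.
Arguments tens {s} X Y : rename.
Arguments tunit {s} : rename.
Arguments tensm {s X Y X' Y'} f g : rename.
Arguments assoc {s X Y Z} : rename.
Arguments associ {s X Y Z} : rename.
Arguments lunit {s X} : rename.
Arguments luniti {s X} : rename.
Arguments runit {s X} : rename.
Arguments runiti {s X} : rename.
Arguments swap {s X Y} : rename.

Notation "X ⊗ Y" := (tens X Y) (at level 40, left associativity) : cat_scope.
Notation "f ⊠ g" := (tensm f g) (at level 40, left associativity) : cat_scope.

(* id ⊗ swap ⊗ id : W ⊗ X ⊗ Y ⊗ Z -> W ⊗ Y ⊗ X ⊗ Z *)
Definition swap_mid (C : symmonoidal) (W X Y Z : C) :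
    (W ⊗ X) ⊗ (Y ⊗ Z) ~> (W ⊗ Y) ⊗ (X ⊗ Z) :=
  associ ∘ idm W ⊠ (assoc ∘ swap ⊠ idm Z ∘ associ) ∘ assoc.

(* swap ⊗ id : X ⊗ Y ⊗ Z -> Y ⊗ X ⊗ Z, bracketed to the right *)
Definition swap_fst (C : symmonoidal) (X Y Z : C) :
    X ⊗ (Y ⊗ Z) ~> Y ⊗ (X ⊗ Z) :=
  assoc ∘ swap ⊠ idm Z ∘ associ.
Arguments swap_mid {C W X Y Z}.
Arguments swap_fst {C X Y Z}.

(* * Markov categories *)

Record markov_category := MarkovCategory {
  markov_smc :> symmonoidal;
  copy : forall X : markov_smc, X ~> X ⊗ X;
  del : forall X : markov_smc, X ~> tunit;
  tunit_terminal : forall (X : markov_smc) (f : X ~> tunit), f = del X;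
  copyA : forall X,
    assoc ∘ copy X ⊠ idm X ∘ copy X = idm X ⊠ copy X ∘ copy X;
  copy_dell : forall X, lunit ∘ del X ⊠ idm X ∘ copy X = idm X;
  copy_delr : forall X, runit ∘ idm X ⊠ del X ∘ copy X = idm X;
  copyC : forall X, swap ∘ copy X = copy X;
  copy_tens : forall X Y, copy (X ⊗ Y) = swap_mid ∘ copy X ⊠ copy Y
}.
Arguments copy {m} X : rename.
Arguments del {m} X : rename.

Section MarkovNotions.
Variable C : markov_category.
Implicit Types A X Y Z : C.

Definition deterministic A X (f : A ~> X) : Prop :=
  f ⊠ f ∘ copy A = copy X ∘ f.

Definition as_eq T A X (m : T ~> A) (f g : A ~> X) : Prop :=
  idm A ⊠ f ∘ copy A ∘ m = idm A ⊠ g ∘ copy A ∘ m.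

Definition fst_marginal A X Y (f : A ~> X ⊗ Y) : A ~> X :=
  runit ∘ idm X ⊠ del Y ∘ f.

Definition is_conditional A X Y (f : A ~> X ⊗ Y) (c : X ⊗ A ~> Y) : Prop :=
  f = idm X ⊠ c ∘ assoc ∘ copy X ⊠ idm A ∘ fst_marginal f ⊠ idm A ∘ copy A.

Definition has_conditionals : Prop :=
  forall A X Y (f : A ~> X ⊗ Y), exists c : X ⊗ A ~> Y, is_conditional f c.

Lemma deterministic_id X : deterministic (idm X).
Proof. by rewrite /deterministic tensm_id comp_idl comp_idr. Qed.

(* * Representability *)

(* The inverse [unsharp] of the bijection C(A, X) -> C_det(A, PX) is part of
   the data; it is determined by [sharp]. *)
Record distribution_object X := DistributionObject {
  dobj :> C;
  sharp : forall A, A ~> X -> A ~> dobj;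
  unsharp : forall A (g : A ~> dobj), deterministic g -> A ~> X;
  sharp_det : forall A (f : A ~> X), deterministic (sharp f);
  sharpK : forall A (f : A ~> X), unsharp (sharp_det f) = f;
  unsharpK : forall A (g : A ~> dobj) (dg : deterministic g),
    sharp (unsharp dg) = g;
  sharp_nat : forall A A' (f : A ~> X) (h : A' ~> A),
    deterministic h -> sharp (f ∘ h) = sharp f ∘ h
}.

Definition representable : Type := forall X, distribution_object X.

Definition samp (P : representable) X : P X ~> X :=
  unsharp (deterministic_id (P X)).

Definition as_compatible (P : representable) : Prop :=
  forall T A X (m : T ~> A) (f g : A ~> X),
    as_eq m f g <-> as_eq m (sharp (P X) f) (sharp (P X) g).

(* * Finite tensor powers *)

Fixpoint tpow X (n : nat) : C :=
  if n is n'.+1 then X ⊗ tpow X n' else tunit.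

Fixpoint tpowm X Y (f : X ~> Y) (n : nat) : tpow X n ~> tpow Y n :=
  if n is n'.+1 then f ⊠ tpowm f n' else idm tunit.

Fixpoint iter_copy X (n : nat) : X ~> tpow X n :=
  if n is n'.+1 then idm X ⊠ iter_copy X n' ∘ copy X else del X.

(* A list s labels the factors of tpow X (size s). Given a sublist t of s,
   [tproj] is the identity on the factors labelled in t and del elsewhere. *)
Fixpoint tproj X (s t : seq nat) :
    subseq t s -> tpow X (size s) ~> tpow X (size t) :=
  match s, t with
  | _, [::] => fun _ => del _
  | [::], y :: t' => fun H => False_rect _ (notF H)
  | x :: s', y :: t' =>
    if y == x as b
      return subseq (if b then t' else y :: t') s' ->
             X ⊗ tpow X (size s') ~> X ⊗ tpow X (size t')
    then fun H => idm X ⊠ tproj X H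
    else fun H => lunit ∘ del X ⊠ tproj X H
  end.

Fact mem_behead (x y : nat) s : (y == x) = false -> x \in y :: s -> x \in s.
Proof. by rewrite inE eq_sym => ->. Qed.

(* Moves the factor labelled x to the front, keeping the order of the others. *)
Fixpoint textract X (x : nat) (s : seq nat) :
    x \in s -> tpow X (size s) ~> X ⊗ tpow X (size (rem x s)) :=
  match s with
  | [::] => fun H => False_rect _ (notF H)
  | y :: s' => fun H =>
    (if y == x as b
       return (y == x) = b -> X ⊗ tpow X (size s') ~>
              X ⊗ tpow X (size (if b then s' else y :: rem x s'))
     then fun _ => idm _
     else fun E => swap_fst ∘ idm X ⊠ textract X (mem_behead E H)) erefl
  end.

Fact perm_map_mem (i : nat -> nat) s x t :
  perm_eq s (map i (x :: t)) -> i x \in s.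
Proof. by move=> /perm_mem ->; rewrite /= mem_head. Qed.

Fact perm_map_rem (i : nat -> nat) s x t :
  perm_eq s (map i (x :: t)) -> perm_eq (rem (i x) s) (map i t).
Proof.
move=> H; rewrite -(perm_cons (i x)).
by rewrite -(permPl (perm_to_rem (perm_map_mem H))).
Qed.

(* The canonical isomorphism whose output factor labelled n is the input factor
   labelled i n. *)
Fixpoint treorder X (i : nat -> nat) (s t : seq nat) :
    perm_eq s (map i t) -> tpow X (size s) ~> tpow X (size t) :=
  match t with
  | [::] => fun _ => del _ (* here s is empty *)
  | x :: t' => fun H =>
    idm X ⊠ treorder X (perm_map_rem H) ∘ textract X (perm_map_mem H)
  end.

(* * Powers X^F for finite F : {fset nat}, factors in increasing order *)

Local Open Scope fset_scope.
Implicit Types F : {fset nat}.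

Definition fenum F : seq nat := sort leq F.

Fact mem_fenum F : fenum F =i F.
Proof. by move=> n; rewrite /fenum mem_sort. Qed.

Fact fenum_uniq F : uniq (fenum F).
Proof. by rewrite /fenum sort_uniq fset_uniq. Qed.

Fact fenum_subseq F' F : F' `<=` F -> subseq (fenum F') (fenum F).
Proof.
move=> /fsubsetP sF.
have sortedF G : sorted ltn (fenum G).
  by rewrite ltn_sorted_uniq_leq fenum_uniq (sort_sorted leq_total).
suff -> : fenum F' = filter (mem F') (fenum F) by apply: filter_subseq.
apply: (irr_sorted_eq ltn_trans ltnn) => //.
  exact: (sorted_filter ltn_trans).
move=> n; rewrite mem_filter !mem_fenum /= andb_idr //; exact: sF.
Qed.

Fact fenum_imfset (i : nat -> nat) F : injective i ->
  perm_eq (fenum [fset i n | n in F]) (map i (fenum F)).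
Proof.
move=> inj_i; apply: uniq_perm; rewrite ?fenum_uniq ?map_inj_uniq ?fenum_uniq //.
move=> n; rewrite mem_fenum; apply/imfsetP/mapP => -[m /= mF ->]; exists m => //.
  by rewrite mem_fenum.
by rewrite -mem_fenum.
Qed.

Definition fpow X F : C := tpow X (size (fenum F)).

Definition fpowm X Y (f : X ~> Y) F : fpow X F ~> fpow Y F :=
  tpowm f (size (fenum F)).

Definition fcopy X F : X ~> fpow X F := iter_copy X (size (fenum F)).

Definition fproj X F F' (sF : F' `<=` F) : fpow X F ~> fpow X F' :=
  tproj X (fenum_subseq sF).

Definition freorder X (i : nat -> nat) (inj_i : injective i) F :
    fpow X [fset i n | n in F] ~> fpow X F :=
  treorder X (fenum_imfset F inj_i).

(* * Countable Kolmogorov powers *)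

Definition compatible_family A X Y (f : forall F, A ~> fpow X F ⊗ Y) : Prop :=
  forall F F' (sF : F' `<=` F), f F' = fproj X sF ⊠ idm Y ∘ f F.

(* [kproj_compatible], [klift], [klift_proj] and [kproj_inj] express that
   f |-> ((π_F ⊗ id) ∘ f)_F is a bijection onto compatible families. *)
Record kolmogorov_power X := KolmogorovPower {
  kobj :> C;
  kproj : forall F, kobj ~> fpow X F;
  kproj_det : forall F, deterministic (kproj F);
  kproj_compatible : forall A Y (f : A ~> kobj ⊗ Y),
    compatible_family (fun F => kproj F ⊠ idm Y ∘ f);
  klift : forall A Y (f : forall F, A ~> fpow X F ⊗ Y),
    compatible_family f -> A ~> kobj ⊗ Y;
  klift_proj : forall A Y (f : forall F, A ~> fpow X F ⊗ Y)
      (cf : compatible_family f) F,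
    kproj F ⊠ idm Y ∘ klift cf = f F;
  kproj_inj : forall A Y (f g : A ~> kobj ⊗ Y),
    (forall F, kproj F ⊠ idm Y ∘ f = kproj F ⊠ idm Y ∘ g) -> f = g
}.

Definition kolmogorov_powers : Type := forall X, kolmogorov_power X.

(* The case Y = I of the universal property. *)

Lemma runitI_nat X X' (f : X ~> X') : f ⊠ idm tunit ∘ runiti = runiti ∘ f.
Proof.
rewrite -[LHS]comp_idl -(runitK X') -!compA; congr (_ ∘ _).
by rewrite compA runit_nat -compA runitiK comp_idr.
Qed.

Definition compatible A X (f : forall F, A ~> fpow X F) : Prop :=
  forall F F' (sF : F' `<=` F), f F' = fproj X sF ∘ f F.

Lemma compatible_runiti A X (f : forall F, A ~> fpow X F) :
  compatible f -> compatible_family (fun F => runiti ∘ f F).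
Proof.
by move=> cf F F' sF; rewrite compA runitI_nat -compA -(cf _ _ sF).
Qed.

Section KolmogorovPower.
Variables (X : C) (K : kolmogorov_power X).

Definition ktuple A (f : forall F, A ~> fpow X F) (cf : compatible f) : A ~> K :=
  runit ∘ klift K (compatible_runiti cf).

Lemma ktuple_proj A (f : forall F, A ~> fpow X F) (cf : compatible f) F :
  kproj K F ∘ ktuple cf = f F.
Proof.
rewrite /ktuple compA -runit_nat -compA klift_proj.
by rewrite compA runitiK comp_idl.
Qed.

Lemma kproj_ext A (f g : A ~> K) :
  (forall F, kproj K F ∘ f = kproj K F ∘ g) -> f = g.
Proof.
move=> fg; suff: runiti ∘ f = runiti ∘ g.
  by move/(congr1 (comp runit)); rewrite !compA runitiK !comp_idl.
by apply: kproj_inj => F; rewrite !compA !runitI_nat -!compA fg.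
Qed.

Lemma kproj_sub F F' (sF : F' `<=` F) : kproj K F' = fproj X sF ∘ kproj K F.
Proof.
have /(_ F F' sF) := kproj_compatible (@runiti _ K).
rewrite !runitI_nat compA runitI_nat -compA.
by move/(congr1 (comp runit)); rewrite !compA runitiK !comp_idl.
Qed.

End KolmogorovPower.
Arguments ktuple {X} K {A f} cf.

(* Naturality of the projections of finite powers. *)

Lemma tensm_compl A X Y Z (f : Y ~> Z) (g : X ~> Y) :
  idm A ⊠ (f ∘ g) = idm A ⊠ f ∘ idm A ⊠ g.
Proof. by rewrite -tensm_comp comp_idl. Qed.

Lemma del_nat X Y (f : X ~> Y) : del Y ∘ f = del X.
Proof. exact: tunit_terminal. Qed.

Lemma tproj_nat X Y (f : X ~> Y) s t (H : subseq t s) :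
  tpowm f (size t) ∘ tproj X H = tproj Y H ∘ tpowm f (size s).
Proof.
elim: s t H => [|x s IHs] [|y t] //= H.
- by rewrite del_nat comp_idl.
- by rewrite comp_idl del_nat.
move: H; case: (y == x) => H.
  by rewrite -!tensm_comp IHs comp_idl comp_idr.
have /= IH := IHs (y :: t) H.
rewrite -compA -tensm_comp del_nat -IH.
rewrite -[del X in RHS]comp_idl tensm_comp [RHS]compA lunit_nat.
by rewrite compA.
Qed.

Lemma tproj_copy X s t (H : subseq t s) :
  tproj X H ∘ iter_copy X (size s) = iter_copy X (size t).
Proof.
elim: s t H => [|x s IHs] [|y t] //= H; rewrite ?del_nat //.
move: H; case: (y == x) => H.
  by rewrite compA -tensm_compl IHs.
have /= IH := IHs (y :: t) H.
rewrite -compA (compA (del X ⊠ _)) -tensm_comp comp_idr IH.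
rewrite -[del X]comp_idl -[X in _ ⊠ X]comp_idr tensm_comp.
by rewrite -compA compA lunit_nat -compA (compA lunit) copy_dell comp_idr.
Qed.

(* Compatibility of the projections with relabelling, along injections. *)

Lemma tensmI_inj X Y (f g : X ~> Y) : idm tunit ⊠ f = idm tunit ⊠ g -> f = g.
Proof.
move=> fg; rewrite -[f]comp_idr -[g]comp_idr -(lunitiK X) !compA -!lunit_nat.
by rewrite fg.
Qed.

Lemma tensm_Iinj X Y (f g : X ~> Y) : f ⊠ idm tunit = g ⊠ idm tunit -> f = g.
Proof.
move=> fg; rewrite -[f]comp_idr -[g]comp_idr -(runitiK X) !compA -!runit_nat.
by rewrite fg.
Qed.

Lemma lunit_tens X Y : lunit ∘ assoc = lunit ⊠ idm Y :> (tunit ⊗ X ⊗ Y ~> X ⊗ Y).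
Proof.
apply: tensmI_inj; rewrite tensm_compl.
suff E : idm tunit ⊠ lunit ∘ idm tunit ⊠ assoc ∘ (assoc ∘ assoc ⊠ idm Y)
       = idm tunit ⊠ (lunit ⊠ idm Y) ∘ (assoc ∘ @assoc C tunit tunit X ⊠ idm Y).
  have K : (assoc ∘ @assoc C tunit tunit X ⊠ idm Y) ∘ (associ ⊠ idm Y ∘ associ)
         = idm _.
    rewrite compA -(compA assoc) -tensm_comp associK comp_idl tensm_id comp_idr.
    exact: associK.
  move/(congr1 (fun h => h ∘ (associ ⊠ idm Y ∘ associ))): E.
  by rewrite -[LHS]compA -[RHS]compA K !comp_idr.
rewrite -compA (compA (_ ⊠ assoc)) -pentagon compA triangle.
rewrite [RHS]compA -assoc_nat -compA -tensm_comp triangle comp_idl.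
by rewrite assoc_nat tensm_id.
Qed.

Lemma lunit_swap X : lunit ∘ swap = runit :> (X ⊗ tunit ~> X).
Proof.
apply: tensm_Iinj.
suff E : swap ∘ (lunit ∘ swap) ⊠ idm tunit = swap ∘ runit ⊠ idm tunit
           :> (X ⊗ tunit ⊗ tunit ~> tunit ⊗ X).
  by move/(congr1 (comp swap)): E; rewrite !compA !swapK !comp_idl.
have := congr1 (comp lunit) (hexagon X tunit tunit).
rewrite -!compA (compA lunit assoc) lunit_tens compA -swap_nat -compA triangle.
move=> ->; rewrite compA lunit_nat -compA (compA lunit) lunit_tens.
by rewrite -tensm_comp comp_idl.
Qed.

Lemma runit_swap X : runit ∘ swap = lunit :> (tunit ⊗ X ~> X).
Proof. by rewrite -lunit_swap -compA swapK comp_idr. Qed.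

Lemma lunit_swap_fst X Y :
  idm X ⊠ lunit ∘ swap_fst = lunit :> (tunit ⊗ (X ⊗ Y) ~> X ⊗ Y).
Proof.
rewrite /swap_fst !compA triangle -tensm_comp comp_idl runit_swap -lunit_tens.
by rewrite -compA associK comp_idr.
Qed.

Lemma swap_fstK X Y Z : swap_fst ∘ swap_fst = idm (X ⊗ (Y ⊗ Z)).
Proof.
rewrite /swap_fst -!compA (compA associ) assocK comp_idl.
by rewrite (compA (swap ⊠ _)) -tensm_comp swapK comp_idl tensm_id comp_idl associK.
Qed.

Lemma swap_fst_lunit X Y :
  lunit ∘ swap_fst = idm X ⊠ lunit :> (X ⊗ (tunit ⊗ Y) ~> X ⊗ Y).
Proof. by rewrite -lunit_swap_fst -compA swap_fstK comp_idr. Qed.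

Lemma associ_nat X Y Z X' Y' Z' (f : X ~> X') (g : Y ~> Y') (h : Z ~> Z') :
  associ ∘ f ⊠ (g ⊠ h) = f ⊠ g ⊠ h ∘ associ.
Proof.
rewrite -[RHS]comp_idl -assocK -!compA (compA assoc) assoc_nat -!compA.
by rewrite associK comp_idr.
Qed.

Lemma swap_fst_nat X Y Z X' Y' Z' (f : X ~> X') (g : Y ~> Y') (h : Z ~> Z') :
  swap_fst ∘ f ⊠ (g ⊠ h) = g ⊠ (f ⊠ h) ∘ swap_fst.
Proof.
rewrite /swap_fst !compA -assoc_nat -compA associ_nat compA; congr (_ ∘ _).
by rewrite -!compA -!tensm_comp swap_nat comp_idl comp_idr.
Qed.

Definition drop_fst X Y : X ⊗ Y ~> Y := lunit ∘ del X ⊠ idm Y.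

Lemma drop_fst_nat X Y X' Y' (g : X ~> X') (f : Y ~> Y') :
  drop_fst X' Y' ∘ g ⊠ f = f ∘ drop_fst X Y.
Proof.
rewrite /drop_fst compA -lunit_nat -!compA -!tensm_comp del_nat.
by rewrite !comp_idl comp_idr.
Qed.

Lemma swap_drop_fst X Y Z :
  idm X ⊠ drop_fst Y Z ∘ swap_fst = drop_fst Y (X ⊗ Z).
Proof.
by rewrite tensm_compl -compA -swap_fst_nat compA lunit_swap_fst tensm_id.
Qed.

Lemma drop_fst_swap X Y Z :
  drop_fst X (Y ⊗ Z) ∘ swap_fst = idm Y ⊠ drop_fst X Z.
Proof. by rewrite -swap_drop_fst -compA swap_fstK comp_idr. Qed.

Lemma tproj_skip X y s t (H : subseq t (y :: s)) (H' : subseq t s) :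
  y \notin s -> tproj X H = tproj X H' ∘ drop_fst X (tpow X (size s)).
Proof.
case: t H H' => [|z t] H H' ys.
  by rewrite [LHS]tunit_terminal [RHS]tunit_terminal.
have zy : (z == y) = false.
  by apply: contraNF ys => /eqP <-; apply: (mem_subseq H'); rewrite mem_head.
move: H; rewrite /=; case: (z == y) zy => // _ H.
rewrite -(drop_fst_nat (idm X)) /drop_fst -compA -tensm_comp comp_idl comp_idr.
by rewrite (bool_irrelevance H H').
Qed.

Lemma subseq_rem (x : nat) s t : uniq s -> x \notin t -> subseq t s -> subseq t (rem x s).
Proof.
move=> us xt ts; rewrite rem_filter // subseq_filter ts andbT.
by apply/allP => y yt /=; apply: contraNneq xt => <-.
Qed.

Lemma subseq_rem2 (x : nat) s t : uniq s -> subseq t s -> subseq (rem x t) (rem x s).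
Proof.
move=> us ts; rewrite !rem_filter ?(subseq_uniq ts) // subseq_filter.
by rewrite filter_all (subseq_trans (filter_subseq _ _)).
Qed.

Lemma tproj_keep X x s t (H : subseq (x :: t) (x :: s)) (H' : subseq t s) :
  tproj X H = idm X ⊠ tproj X H'.
Proof.
move: H => /=; case: (x == x) (eqxx x) => // _ H.
by rewrite (bool_irrelevance H H').
Qed.

Lemma textract_elim X x y s (H : x \in y :: s)
    (Q : forall s0, tpow X (size (y :: s)) ~> X ⊗ tpow X (size s0) -> Prop) :
  (y = x -> Q s (idm _)) ->
  (forall E : (y == x) = false,
     Q (y :: rem x s) (swap_fst ∘ idm X ⊠ textract X (mem_behead E H))) ->
  Q (rem x (y :: s)) (textract X H).
Proof.
rewrite /=; move: (@mem_behead x y s); case: eqP => [yx|_] b Q1 Q2; first exact: Q1.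
exact: Q2.
Qed.

Lemma textract_tproj X x s t (H : subseq t s) (xs : x \in s) (xt : x \in t)
    (H' : subseq (rem x t) (rem x s)) : uniq s ->
  textract X xt ∘ tproj X H = idm X ⊠ tproj X H' ∘ textract X xs.
Proof.
elim: s t H xs xt H' => [|y s IHs] t H xs xt H' //= /andP[ys us].
pose Q s0 e := forall H' : subseq (rem x t) s0,
  textract X xt ∘ tproj X H = idm X ⊠ tproj X H' ∘ e.
apply: (@textract_elim X x y s xs Q); rewrite /Q {Q H'}.
  move=> yx; subst y; case: t H xt => [|z t] // H xt.
  have zx : z = x.
    have := H; rewrite /=; case: eqP => // _ ts.
    by case/negP: ys; apply: (mem_subseq ts).
  subst z.
  pose Q t0 e := forall H' : subseq t0 s,
    e ∘ tproj X H = idm X ⊠ tproj X H' ∘ idm _.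
  apply: (@textract_elim X x x t xt Q); rewrite /Q {Q}; last by move=> E; have := E; rewrite {1}eqxx.
  by move=> _ H'; rewrite comp_idl comp_idr; apply: tproj_keep.
move=> yx H'; have xs' := mem_behead yx xs.
rewrite (bool_irrelevance (mem_behead yx xs) xs').
have [yt|yt] := boolP (y \in t); last first.
  have ts : subseq t s.
    by have := subseq_rem (x := y) _ yt H; rewrite /= eqxx; apply; rewrite ys.
  have ts' := subseq_rem2 x us ts.
  rewrite (tproj_skip _ H ts ys) (tproj_skip _ H' ts'); last first.
    by apply: contra ys; apply: mem_rem.
  rewrite compA (IHs _ ts xs' xt ts') // tensm_compl -[LHS]compA -[RHS]compA; congr (_ ∘ _).
  by rewrite [in RHS]compA swap_drop_fst drop_fst_nat.
case: t H xt yt H' => [|z t] // H xt yt.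
have zy : z = y.
  have := H; rewrite /=; case: eqP => // _ ts.
  by case/negP: ys; apply: (mem_subseq ts).
subst z; have ts : subseq t s by have := H; rewrite /= eqxx.
pose Q t0 e := forall H' : subseq t0 (y :: rem x s),
  e ∘ tproj X H =
  idm X ⊠ tproj X H' ∘ (swap_fst ∘ idm X ⊠ textract X xs').
apply: (@textract_elim X x y t xt Q); rewrite /Q {Q}.
  by move/eqP; rewrite yx.
move=> E H'; rewrite (tproj_keep _ H ts) (tproj_keep _ H' (subseq_rem2 x us ts)).
rewrite compA -swap_fst_nat -!compA -!tensm_comp comp_idl.
by rewrite (IHs _ ts xs' (mem_behead E xt) (subseq_rem2 x us ts)).
Qed.

Lemma tproj_rem X x s t (H : subseq t s) (xs : x \in s)
    (H' : subseq t (rem x s)) : uniq s -> x \notin t ->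
  tproj X H = tproj X H' ∘ (drop_fst X (tpow X (size (rem x s))) ∘ textract X xs).
Proof.
elim: s t H xs H' => [|y s IHs] t H xs H' //= /andP[ys us] xt.
pose Q s0 e := forall H' : subseq t s0,
  tproj X H = tproj X H' ∘ (drop_fst X (tpow X (size s0)) ∘ e).
apply: (@textract_elim X x y s xs Q); rewrite /Q {Q H'}.
  move=> yx; subst y => H'; rewrite comp_idr; exact: tproj_skip.
move=> yx H'; set xs' := mem_behead yx xs.
have ysr : y \notin rem x s by apply: contra ys; apply: mem_rem.
have [yt|yt] := boolP (y \in t); last first.
  have ts : subseq t s.
    by have := subseq_rem (x := y) _ yt H; rewrite /= eqxx; apply; rewrite ys.
  have ts' := subseq_rem us xt ts.
  rewrite (tproj_skip _ H ts ys) (tproj_skip _ H' ts' ysr) (IHs _ ts xs' ts') //.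
  rewrite -[LHS]compA -[RHS]compA; congr (_ ∘ _).
  by rewrite [X in _ = _ ∘ X]compA drop_fst_swap -tensm_comp comp_idl drop_fst_nat.
case: t H xt yt H' => [|z t] // H xt yt.
have zy : z = y.
  have := H; rewrite /=; case: eqP => // _ ts.
  by case/negP: ys; apply: (mem_subseq ts).
subst z; have ts : subseq t s by have := H; rewrite /= eqxx.
have xt' : x \notin t by apply: contra xt; rewrite inE orbC => ->.
have ts' := subseq_rem us xt' ts.
move=> H'; rewrite (tproj_keep _ H ts) (tproj_keep _ H' ts').
rewrite [X in _ = _ ∘ X]compA drop_fst_swap -!tensm_comp !comp_idl.
by rewrite -(IHs _ ts xs' ts').
Qed.

Lemma treorder_tproj X (i : nat -> nat) s t s' t'
    (P : perm_eq s (map i t)) (P' : perm_eq s' (map i t'))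
    (H : subseq t' t) (H' : subseq s' s) : injective i -> uniq t ->
  treorder X P' ∘ tproj X H' = tproj X H ∘ treorder X P.
Proof.
move=> inj_i; elim: t s s' t' P P' H H' => [|x t IHt] s s' t' P P' H H' ut.
  by case: t' P' H => // P' H; rewrite [LHS]tunit_terminal [RHS]tunit_terminal.
have us : uniq s by rewrite (perm_uniq P) map_inj_uniq.
case/andP: ut => xt ut.
have [xt'|xt'] := boolP (x \in t').
  case: t' P' H xt' => [|z t'] // P' H xt'.
  have zx : z = x.
    have := H; rewrite /=; case: eqP => // _ ts.
    by case/negP: xt; apply: (mem_subseq ts).
  subst z; have ts : subseq t' t by have := H; rewrite /= eqxx.
  have Hr := subseq_rem2 (i x) us H'.
  rewrite (tproj_keep _ H ts) /= -compA.
  rewrite (textract_tproj _ H' (perm_map_mem P) (perm_map_mem P') Hr us).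
  rewrite !compA -!tensm_comp !comp_idl.
  by rewrite (IHt _ _ _ (perm_map_rem P) (perm_map_rem P') ts Hr).
have ts : subseq t' t.
  have := subseq_rem (x := x) _ xt' H; rewrite /= eqxx; apply.
  by rewrite xt.
have ixs : i x \notin s' by rewrite (perm_mem P') mem_map.
have Hr := subseq_rem us ixs H'.
rewrite (tproj_skip _ H ts xt) (tproj_rem _ H' (perm_map_mem P) Hr us ixs) /=.
rewrite compA (IHt _ _ _ (perm_map_rem P) P' ts Hr) //.
rewrite -[LHS]compA -[RHS]compA; congr (_ ∘ _).
by rewrite [LHS]compA [RHS]compA drop_fst_nat.
Qed.

(* * Powers of morphisms, countable copy, reindexing, exchangeability *)

Lemma compatible_fpowm X Y (KX : kolmogorov_power X) (f : X ~> Y) :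
  compatible (fun F => fpowm f F ∘ kproj KX F).
Proof.
by move=> F F' sF; rewrite (kproj_sub KX sF) !compA /fpowm /fproj tproj_nat.
Qed.

Definition kpowm X Y (KX : kolmogorov_power X) (KY : kolmogorov_power Y)
    (f : X ~> Y) : KX ~> KY :=
  ktuple KY (compatible_fpowm KX f).

Lemma compatible_fcopy X : compatible (fcopy X).
Proof. by move=> F F' sF; rewrite /fcopy /fproj tproj_copy. Qed.

Definition kcopy X (KX : kolmogorov_power X) : X ~> KX :=
  ktuple KX (@compatible_fcopy X).

Lemma compatible_freorder X (KX : kolmogorov_power X) (i : nat -> nat)
    (inj_i : injective i) :
  compatible (fun F => freorder X inj_i F ∘ kproj KX [fset i n | n in F]).
Proof.
move=> F F' sF; have siF : [fset i n | n in F'] `<=` [fset i n | n in F].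
  apply/fsubsetP => _ /imfsetP[n /= nF ->].
  by apply: in_imfset; apply: (fsubsetP sF).
rewrite (kproj_sub KX siF) !compA; congr (_ ∘ _).
by apply: treorder_tproj => //; apply: fenum_uniq.
Qed.

(* X^i for an injection i *)
Definition kreindex X (KX : kolmogorov_power X) (i : nat -> nat)
    (inj_i : injective i) : KX ~> KX :=
  ktuple KX (compatible_freorder KX inj_i).

Definition exchangeable A X (KX : kolmogorov_power X) (p : A ~> KX) : Prop :=
  forall (s : nat -> nat) (bij_s : bijective s),
    (exists F, forall n, n \notin F -> s n = n) ->
    kreindex KX (bij_inj bij_s) ∘ p = p.

End MarkovNotions.

(* Main.v *)
From mathcomp Require Import all_boot finmap.
Require Import Defs.

Set Implicit Arguments.
Unset Strict Implicit.
Unset Printing Implicit Defensive.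

Local Open Scope cat_scope.

(** The idea, in the language of random variables.  Let S = (X_0, X_1, ...) be
    exchangeable with parameter a, let T S = (X_1, X_2, ...) be its tail, and let
    psi be a conditional distribution of the head X_0 given the tail and a.
    Write D = d (S, a) with d the deterministic map psi^# into PX; then psi is
    samp after d.

    (1) Permuting the tail does not change its joint law with X_0, so psi is
    almost surely invariant under finite permutations, by uniqueness of
    conditionals.  Almost sure compatibility of representability transfers
    this from psi to d.

    (2) Hence the joint law of (S, a, D) is invariant under finite permutations
    of S.  On any finite set of coordinates the shift agrees with a finite
    permutation, and a morphism into a Kolmogorov power (tensored with another
    object) is determined by finite marginals; so (T S, a, D) has the same
    law as (S, a, D) ([shift_invariant]).

    (3) Condition X_0 on (T S, a, D).  As (T S, a, D) has the law of
    (S, a, d (S, a)), this conditional is, almost surely, a function of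
    (T S, a) alone, hence equal to psi.  So (X_0, T S, a, D) has the law of
    (samp D, S, a, D) ([cond_stationary]): splitting off the head amounts to
    sampling D, and leaves the joint law of the rest unchanged.  Iterating, X_0, ..., X_{n-1} are
    independent samples of D ([iid_stationary]), and mu is the law of D.

    The converse holds because reordering the factors of a finite power commutes
    with iterated copying and with powers of a morphism.

    Diagrams are handled through the pairing ⟨f, g⟩ = (f ⊗ g) ∘ copy, with the
    coherence isomorphisms left in place.  Deterministic morphisms form a
    cartesian category in which ⟨_, _⟩ is the universal pairing, so they are
    compared coordinate by coordinate, also when they land in finite or countable
    powers of X.  That the structural isomorphisms are deterministic is deduced
    from conditionals ([det_iso]). *)

Section MarkovCategory.
Variable C : markov_category.
Hypothesis conds : has_conditionals C.
Implicit Types A B W X Y Z : C.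

(** * Pairing and projections *)

(** These are locked because associativity rewriting would otherwise unfold
    them: each of them is itself a composite. *)
Definition pair A X Y (f : A ~> X) (g : A ~> Y) : A ~> X ⊗ Y :=
  locked (f ⊠ g ∘ copy A).
Definition pfst X Y : X ⊗ Y ~> X := locked (runit ∘ idm X ⊠ del Y).
Definition psnd X Y : X ⊗ Y ~> Y := locked (drop_fst X Y).

Local Notation "⟨ f , g ⟩" := (pair f g) (at level 0, f at level 99, g at level 99).

Lemma pairE A X Y (f : A ~> X) (g : A ~> Y) : ⟨f, g⟩ = f ⊠ g ∘ copy A.
Proof. by rewrite /pair -lock. Qed.

Lemma pfstE X Y : pfst X Y = runit ∘ idm X ⊠ del Y.
Proof. by rewrite /pfst -lock. Qed.

Lemma psndE X Y : psnd X Y = drop_fst X Y.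
Proof. by rewrite /psnd -lock. Qed.

Lemma copyE X : copy X = ⟨idm X, idm X⟩.
Proof. by rewrite !pairE tensm_id comp_idl. Qed.

Lemma tens_pair A X Y X' Y' (f : X ~> X') (g : Y ~> Y') (u : A ~> X) (v : A ~> Y) :
  f ⊠ g ∘ ⟨u, v⟩ = ⟨f ∘ u, g ∘ v⟩.
Proof. by rewrite !pairE compA -tensm_comp. Qed.

Lemma pfst_nat X Y X' Y' (f : X ~> X') (g : Y ~> Y') :
  pfst X' Y' ∘ f ⊠ g = f ∘ pfst X Y.
Proof.
by rewrite !pfstE compA -runit_nat -!compA -!tensm_comp del_nat !comp_idl comp_idr.
Qed.

Lemma psnd_nat X Y X' Y' (f : X ~> X') (g : Y ~> Y') :
  psnd X' Y' ∘ f ⊠ g = g ∘ psnd X Y.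
Proof. by rewrite !psndE; exact: drop_fst_nat. Qed.

Lemma pfst_pair A X Y (f : A ~> X) (g : A ~> Y) : pfst X Y ∘ ⟨f, g⟩ = f.
Proof. by rewrite !pairE compA pfst_nat -compA pfstE copy_delr comp_idr. Qed.

Lemma psnd_pair A X Y (f : A ~> X) (g : A ~> Y) : psnd X Y ∘ ⟨f, g⟩ = g.
Proof. by rewrite !pairE compA psnd_nat -compA psndE copy_dell comp_idr. Qed.

Lemma swap_pair A X Y (f : A ~> X) (g : A ~> Y) : swap ∘ ⟨f, g⟩ = ⟨g, f⟩.
Proof. by rewrite !pairE compA swap_nat -compA copyC. Qed.

Lemma assoc_pair A X Y Z (f : A ~> X) (g : A ~> Y) (h : A ~> Z) :
  assoc ∘ ⟨⟨f, g⟩, h⟩ = ⟨f, ⟨g, h⟩⟩.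
Proof.
rewrite !pairE -{1}[h]comp_idr tensm_comp !compA assoc_nat -!compA.
by rewrite (compA assoc) copyA compA -tensm_comp comp_idr.
Qed.

Lemma associ_pair A X Y Z (f : A ~> X) (g : A ~> Y) (h : A ~> Z) :
  associ ∘ ⟨f, ⟨g, h⟩⟩ = ⟨⟨f, g⟩, h⟩.
Proof. by rewrite -assoc_pair compA assocK comp_idl. Qed.

Lemma swap_fst_pair A X Y Z (f : A ~> X) (g : A ~> Y) (h : A ~> Z) :
  swap_fst ∘ ⟨f, ⟨g, h⟩⟩ = ⟨g, ⟨f, h⟩⟩.
Proof.
by rewrite /swap_fst -!compA associ_pair tens_pair swap_pair comp_idl assoc_pair.
Qed.

Lemma swap_mid_pair A W X Y Z (e : A ~> W) (f : A ~> X) (g : A ~> Y) (h : A ~> Z) :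
  swap_mid ∘ ⟨⟨e, f⟩, ⟨g, h⟩⟩ = ⟨⟨e, g⟩, ⟨f, h⟩⟩.
Proof.
rewrite /swap_mid -!compA assoc_pair tens_pair comp_idl -!compA associ_pair.
by rewrite tens_pair swap_pair comp_idl assoc_pair associ_pair.
Qed.

Lemma swap_mid_nat W X Y Z W' X' Y' Z' (e : W ~> W') (f : X ~> X')
    (g : Y ~> Y') (h : Z ~> Z') :
  swap_mid ∘ (e ⊠ f) ⊠ (g ⊠ h) = (e ⊠ g) ⊠ (f ⊠ h) ∘ swap_mid.
Proof.
rewrite /swap_mid -/(swap_fst) -compA assoc_nat !compA; congr (_ ∘ _).
rewrite -compA -tensm_comp comp_idl swap_fst_nat -{1}[e]comp_idr tensm_comp.
by rewrite compA associ_nat.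
Qed.

(** I ⊗ I is isomorphic to I, hence terminal too. *)
Lemma to_tunit2 A (f g : A ~> tunit ⊗ tunit) : f = g.
Proof.
rewrite -[f]comp_idl -[g]comp_idl -lunitK -!compA.
by rewrite (tunit_terminal (lunit ∘ f)) -(tunit_terminal (lunit ∘ g)).
Qed.

(** Deleting the two inner factors of copy_X ⊗ copy_Y leaves identities; the swap
    performed by copy_{X ⊗ Y} then acts on I ⊗ I, where it is trivial. *)
Lemma pair_fst_snd X Y : ⟨pfst X Y, psnd X Y⟩ = idm (X ⊗ Y).
Proof.
rewrite pairE pfstE psndE /drop_fst copy_tens tensm_comp -compA.
rewrite (compA (_ ⊠ _) swap_mid) -swap_mid_nat.
have -> : @swap_mid C X tunit tunit Y = idm _.
  rewrite /swap_mid (to_tunit2 swap (idm _)) tensm_id comp_idr associK tensm_id.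
  by rewrite comp_idr assocK.
rewrite comp_idl -!tensm_comp !compA.
by rewrite copy_delr copy_dell tensm_id.
Qed.

(** * Deterministic morphisms *)

Lemma pair_det A B X Y (f : A ~> X) (g : A ~> Y) (h : B ~> A) :
  deterministic h -> ⟨f, g⟩ ∘ h = ⟨f ∘ h, g ∘ h⟩.
Proof. by move=> dh; rewrite -tens_pair !pairE -compA dh compA. Qed.

Lemma pair_eta A X Y (h : A ~> X ⊗ Y) :
  deterministic h -> ⟨pfst X Y ∘ h, psnd X Y ∘ h⟩ = h.
Proof. by move=> dh; rewrite -pair_det // pair_fst_snd comp_idl. Qed.

Lemma det_comp A X Y (g : X ~> Y) (f : A ~> X) :
  deterministic g -> deterministic f -> deterministic (g ∘ f).
Proof.
by move=> dg df; rewrite /deterministic tensm_comp -compA df compA dg compA.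
Qed.

Lemma det_tens X Y X' Y' (f : X ~> X') (g : Y ~> Y') :
  deterministic f -> deterministic g -> deterministic (f ⊠ g).
Proof.
move=> df dg; rewrite /deterministic !copy_tens compA -swap_mid_nat -!compA.
by rewrite -!tensm_comp df dg.
Qed.

Lemma det_copy X : deterministic (copy X).
Proof.
rewrite /deterministic copy_tens -compA -pairE !copyE.
by rewrite swap_mid_pair.
Qed.

Lemma det_pair A X Y (f : A ~> X) (g : A ~> Y) :
  deterministic f -> deterministic g -> deterministic ⟨f, g⟩.
Proof. by move=> df dg; rewrite pairE; apply: det_comp (det_copy A); apply: det_tens. Qed.

Lemma det_del X : deterministic (del X).
Proof. exact: to_tunit2. Qed.

(** An instance of positivity.  In the joint law ⟨g, id⟩ ∘ f of (g y, y) for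
    y = f x, the first component is x itself.  The conditional of y given (x, x)
    thus computes the marginal f, which makes the joint law ⟨id, f⟩; applying f
    to the first component turns (g y, y) into (y, y), and ⟨id, f⟩ into ⟨f, f⟩. *)
Lemma det_iso X Y (f : X ~> Y) (g : Y ~> X) :
  g ∘ f = idm X -> f ∘ g = idm Y -> deterministic f.
Proof.
move=> gf fg; have [c] := conds (⟨g, idm Y⟩ ∘ f).
rewrite /is_conditional.
have -> : fst_marginal (⟨g, idm Y⟩ ∘ f) = idm X.
  by rewrite /fst_marginal compA -pfstE pfst_pair.
rewrite tensm_id comp_idr -!compA (compA assoc) copyA compA -tensm_comp comp_idl.
rewrite -pairE => e.
have fc : f = c ∘ copy X.
  by have := congr1 (comp (psnd X Y)) e; rewrite compA !psnd_pair comp_idl.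
have := congr1 (comp (f ⊠ idm Y)) e; rewrite compA !tens_pair comp_idr -fc fg.
by rewrite !comp_idl comp_idr -copyE /deterministic => ->; rewrite pairE.
Qed.

Lemma det_assoc X Y Z : deterministic (@assoc C X Y Z).
Proof. exact: det_iso (assocK _ _ _) (associK _ _ _). Qed.

Lemma det_associ X Y Z : deterministic (@associ C X Y Z).
Proof. exact: det_iso (associK _ _ _) (assocK _ _ _). Qed.

Lemma det_swap X Y : deterministic (@swap C X Y).
Proof. exact: det_iso (swapK _ _) (swapK _ _). Qed.

Lemma det_pfst X Y : deterministic (pfst X Y).
Proof.
rewrite pfstE; apply: det_comp; first exact: det_iso (runitK _) (runitiK _).
by apply: det_tens; [exact: deterministic_id | exact: det_del].
Qed.

Lemma det_psnd X Y : deterministic (psnd X Y).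
Proof.
rewrite psndE; apply: det_comp; first exact: det_iso (lunitK _) (lunitiK _).
by apply: det_tens; [exact: det_del | exact: deterministic_id].
Qed.

Lemma det_swap_fst X Y Z : deterministic (@swap_fst C X Y Z).
Proof.
apply: det_comp; last exact: det_associ.
apply: det_comp; first exact: det_assoc.
by apply: det_tens; [exact: det_swap | exact: deterministic_id].
Qed.


Local Hint Resolve deterministic_id det_comp det_tens det_copy det_pair det_del
  det_assoc det_associ det_swap det_pfst det_psnd det_swap_fst : det.

Local Ltac det := by auto 12 with det.

(** The input of p is copied before or after sampling p: the two agree,
    since only the deterministic input is duplicated. *)
Lemma pair_graph A Y Z (g : Y ⊗ A ~> Z) (p : A ~> Y) :
  ⟨g, psnd Y A⟩ ∘ ⟨p, idm A⟩ = ⟨g ∘ ⟨p, idm A⟩, idm A⟩.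
Proof.
have E : ⟨idm (Y ⊗ A), psnd Y A⟩ = associ ∘ idm Y ⊠ copy A.
  have -> : idm Y ⊠ copy A = ⟨pfst Y A, ⟨psnd Y A, psnd Y A⟩⟩.
    rewrite -[LHS]comp_idr -pair_fst_snd tens_pair comp_idl copyE pair_det ?comp_idl //.
    det.
  by rewrite associ_pair pair_fst_snd.
have -> : ⟨g, psnd Y A⟩ = g ⊠ idm A ∘ ⟨idm (Y ⊗ A), psnd Y A⟩.
  by rewrite tens_pair comp_idr comp_idl.
by rewrite E -!compA tens_pair !comp_idr comp_idl copyE associ_pair tens_pair comp_idl.
Qed.

(** Conditionals in terms of deterministic functions u, v of a random m.  The
    conditional of v given u a priori depends also on the input in A; here that
    input can be read off from m by the function a, which factors through u. *)
Lemma conditional_exists A W U V (m : A ~> W) (a : W ~> A) (u : W ~> U) (v : W ~> V)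
    (w : U ~> A) :
  ⟨idm W, a⟩ ∘ m = ⟨m, idm A⟩ -> deterministic u -> deterministic w -> w ∘ u = a ->
  exists c : U ~> V, ⟨u, v⟩ ∘ m = ⟨u, c ∘ u⟩ ∘ m.
Proof.
move=> am du dw wu; have [c] := conds (⟨u, v⟩ ∘ m); rewrite /is_conditional.
have -> : fst_marginal (⟨u, v⟩ ∘ m) = u ∘ m.
  by rewrite /fst_marginal compA -pfstE pfst_pair.
have ua : ⟨u ∘ m, idm A⟩ = ⟨idm U, w⟩ ∘ u ∘ m.
  by rewrite pair_det // comp_idl wu -[idm A]comp_idl -tens_pair -am compA
     tens_pair comp_idr comp_idl.
rewrite -compA -pairE ua => ->; exists (c ∘ ⟨idm U, w⟩).
rewrite !compA; congr (_ ∘ _).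
rewrite -(compA _ _ ⟨_, _⟩) tens_pair comp_idl comp_idr copyE.
by rewrite -(compA _ assoc) assoc_pair tens_pair comp_idl pair_det // comp_idl.
Qed.

(** * Coordinates of finite powers *)

Section Coordinates.
Variable X : C.

Fixpoint ttuple B n (g : nat -> B ~> X) : B ~> tpow X n :=
  if n is n'.+1 then ⟨g 0, ttuple n' (fun k => g k.+1)⟩ else del B.

Lemma det_ttuple B n (g : nat -> B ~> X) :
  (forall k, deterministic (g k)) -> deterministic (ttuple n g).
Proof. by elim: n g => [|n IHn] g dg /=; [det | apply: det_pair; auto]. Qed.

Lemma ttuple_comp A B n (g : nat -> B ~> X) (h : A ~> B) :
  deterministic h -> ttuple n g ∘ h = ttuple n (fun k => g k ∘ h).
Proof.
move=> dh; elim: n g => [|n IHn] g /=; first exact: del_nat.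
by rewrite pair_det // IHn.
Qed.

Lemma eq_ttuple B n (g g' : nat -> B ~> X) :
  (forall k, k < n -> g k = g' k) -> ttuple n g = ttuple n g'.
Proof.
elim: n g g' => [|n IHn] g g' eg //=; rewrite eg //; congr (⟨_, _⟩).
by apply: IHn => k kn; apply: eg.
Qed.

Lemma det_textract x s (xs : x \in s) : deterministic (textract X xs).
Proof.
elim: s xs => [|y s IHs] //= xs.
apply: (@textract_elim C X x y s xs (fun _ e => deterministic e)) => E; first det.
by apply: det_comp; [det | apply: det_tens; [det | exact: IHs]].
Qed.

Definition tcoord x s (xs : x \in s) : tpow X (size s) ~> X :=
  pfst _ _ ∘ textract X xs.

Lemma det_tcoord x s (xs : x \in s) : deterministic (tcoord xs).
Proof. by apply: det_comp; [det | exact: det_textract]. Qed.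

Lemma pfst_swap_fst U V W :
  pfst V (U ⊗ W) ∘ swap_fst = pfst V W ∘ psnd U (V ⊗ W).
Proof.
have E : idm (U ⊗ (V ⊗ W)) =
    ⟨pfst _ _, ⟨pfst _ _ ∘ psnd _ _, psnd _ _ ∘ psnd _ _⟩⟩.
  by rewrite -pair_det; [rewrite pair_fst_snd comp_idl pair_fst_snd | det].
by rewrite -[swap_fst]comp_idr E swap_fst_pair pfst_pair.
Qed.

Lemma tcoord_head x s (xs : x \in x :: s) : tcoord xs = pfst X (tpow X (size s)).
Proof.
rewrite /tcoord.
apply: (@textract_elim C X x x s xs (fun s0 e => pfst X (tpow X (size s0)) ∘ e = pfst _ _)).
  by rewrite comp_idr.
by move=> E; have := E; rewrite {1}eqxx.
Qed.

Lemma tcoord_cons x y s (xs : x \in y :: s) (xs' : x \in s) :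
  y != x -> tcoord xs = tcoord xs' ∘ psnd X (tpow X (size s)).
Proof.
move=> yx; rewrite /tcoord.
apply: (@textract_elim C X x y s xs (fun s0 e => pfst X (tpow X (size s0)) ∘ e =
  pfst _ _ ∘ textract X xs' ∘ psnd _ _)).
  by move/eqP; rewrite (negbTE yx).
move=> E; rewrite (bool_irrelevance (mem_behead E xs) xs') compA pfst_swap_fst.
by rewrite -!compA psnd_nat.
Qed.

Lemma tcoord_tproj x s t (H : subseq t s) (xs : x \in s) (xt : x \in t) :
  uniq s -> tcoord xt ∘ tproj X H = tcoord xs.
Proof.
move=> us; rewrite /tcoord -compA.
rewrite (textract_tproj _ H xs xt (subseq_rem2 x us H) us).
by rewrite compA pfst_nat comp_idl.
Qed.

Lemma tcoord_rem x y s (xs : x \in s) (ys : y \in s) (xr : x \in rem y s) :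
  x != y -> uniq s -> tcoord xr ∘ (psnd _ _ ∘ textract X ys) = tcoord xs.
Proof.
move=> xy us; have xx : x \in [:: x] by rewrite mem_head.
have H : subseq [:: x] s by rewrite sub1seq.
have H' : subseq [:: x] (rem y s) by rewrite sub1seq.
have yx : y \notin [:: x] by rewrite inE eq_sym.
rewrite -(tcoord_tproj H xs xx) // -(tcoord_tproj H' xr xx) ?rem_uniq //.
by rewrite (tproj_rem X H ys H' us yx) psndE !compA.
Qed.

Lemma tcoord_treorder i s t (P : perm_eq s (map i t)) x (xt : x \in t) (ixs : i x \in s) :
  injective i -> uniq t -> tcoord xt ∘ treorder X P = tcoord ixs.
Proof.
move=> inj_i; elim: t s P xt ixs => [|y t IHt] s P xt ixs //= /andP[yt ut].
have us : uniq s by rewrite (perm_uniq P) map_inj_uniq //= yt.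
have [xy|xy] := eqVneq y x.
  subst y; rewrite tcoord_head compA pfst_nat comp_idl /tcoord.
  by rewrite (bool_irrelevance (perm_map_mem P) ixs).
have xt' : x \in t by move: xt; rewrite inE eq_sym (negbTE xy).
have xr : i x \in rem (i y) s.
  by rewrite (perm_mem (perm_map_rem P)) map_f.
rewrite (tcoord_cons xt xt') // -[LHS]compA [Z in _ ∘ Z]compA psnd_nat -[Z in _ ∘ Z]compA [LHS]compA.
rewrite (IHt _ (perm_map_rem P) xt' xr) //.
by apply: tcoord_rem => //; rewrite (inj_eq inj_i) eq_sym.
Qed.

(** For deterministic morphisms a finite tensor power is a cartesian power. *)
Lemma ttuple_tcoord B s (f : B ~> tpow X (size s)) (g : nat -> B ~> X) :
  deterministic f -> uniq s ->
  (forall x (xs : x \in s), tcoord xs ∘ f = g x) ->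
  f = ttuple (size s) (fun k => g (nth 0 s k)).
Proof.
elim: s f => [|y s IHs] f df /=; first by move=> _ _; exact: tunit_terminal.
case/andP=> ys us fg; rewrite -[LHS]pair_eta //; congr (⟨_, _⟩).
  by rewrite -(fg _ (mem_head y s)) tcoord_head.
apply: IHs => // [|x xs]; first det.
have xs' : x \in y :: s by rewrite inE xs orbT.
rewrite -(fg x xs') (tcoord_cons xs' xs) ?compA //.
by apply: contraNneq ys => ->.
Qed.
End Coordinates.

Local Open Scope fset_scope.

(** * Initial segments and permutations *)

Definition initial n : {fset nat} := [fset k | k in iota 0 n].

Lemma mem_initial n k : (k \in initial n) = (k < n).
Proof. by rewrite inE /= mem_iota. Qed.

Lemma fenum_initial n : fenum (initial n) = iota 0 n.
Proof.
apply: (irr_sorted_eq ltn_trans ltnn).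
- by rewrite ltn_sorted_uniq_leq fenum_uniq (sort_sorted leq_total).
- exact: iota_ltn_sorted.
by move=> k; rewrite mem_fenum mem_initial mem_iota.
Qed.

Lemma sub_initial (F : {fset nat}) : exists n, F `<=` initial n.
Proof.
exists (\max_(k <- F) k).+1; apply/fsubsetP => k kF.
by rewrite mem_initial ltnS leq_bigmax_seq.
Qed.

(** The shift is not a permutation; on coordinates below n, the finite permutation
    [cyc n] stands in for it. *)
Definition cyc n k := if k < n then k.+1 else if k == n then 0 else k.

Lemma bij_cyc n : bijective (cyc n).
Proof.
exists (fun k => if k == 0 then n else if k <= n then k.-1 else k) => k; rewrite /cyc.
  have [kn|nk|->] //= := ltngtP k n; first by rewrite kn.
  by rewrite gtn_eqF ?(leq_trans _ nk) // leqNgt nk.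
case: k => [|k] /=; first by rewrite ltnn eqxx.
have [kn|nk] := ltnP k n; first by rewrite kn.
by rewrite ltnNge ltnW //= gtn_eqF.
Qed.

(** On sequences, lift_perm s fixes the head and acts as s on the tail. *)
Definition lift_perm (s : nat -> nat) k := if k is k'.+1 then (s k').+1 else 0.

Lemma bij_lift_perm s : bijective s -> bijective (lift_perm s).
Proof.
by case=> r sr rs; exists (lift_perm r) => [] [|k] //=; rewrite ?sr ?rs.
Qed.

(** * Coordinates of Kolmogorov powers *)

Section Powers.
Variables (X : C) (K : kolmogorov_power X).

Fact mem_fenum1 x : x \in fenum [fset x].
Proof. by rewrite mem_fenum inE. Qed.

Definition kcoord x : K ~> X := tcoord X (mem_fenum1 x) ∘ kproj K [fset x].

Lemma det_kcoord x : deterministic (kcoord x).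
Proof. by apply: det_comp; [exact: det_tcoord | exact: kproj_det]. Qed.
Local Hint Resolve det_kcoord : det.

Lemma tcoord_kproj F x (xF : x \in fenum F) : tcoord X xF ∘ kproj K F = kcoord x.
Proof.
have sF : [fset x] `<=` F by rewrite fsub1set -mem_fenum.
rewrite /kcoord (kproj_sub K sF) compA; congr (_ ∘ _).
by rewrite /fproj (tcoord_tproj X (fenum_subseq sF) xF (mem_fenum1 x)) // fenum_uniq.
Qed.

Lemma kprojE F :
  kproj K F = ttuple (size (fenum F)) (fun k => kcoord (nth 0 (fenum F) k)).
Proof.
apply: ttuple_tcoord => [||x xF]; [exact: kproj_det | exact: fenum_uniq |].
exact: tcoord_kproj.
Qed.

Lemma kproj_initial n :
  kproj K (initial n) = ttuple (size (fenum (initial n))) kcoord.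
Proof.
rewrite kprojE; apply: eq_ttuple => k.
by rewrite fenum_initial size_iota => kn; rewrite nth_iota.
Qed.

Lemma kproj_ext_initial B (f g : B ~> K) :
  (forall n, kproj K (initial n) ∘ f = kproj K (initial n) ∘ g) -> f = g.
Proof.
move=> fg; apply: kproj_ext => F; have [n sF] := sub_initial F.
by rewrite (kproj_sub K sF) -!compA fg.
Qed.

Lemma kcoord_ext B (f g : B ~> K) : deterministic f -> deterministic g ->
  (forall x, kcoord x ∘ f = kcoord x ∘ g) -> f = g.
Proof.
move=> df dg fg; apply: kproj_ext => F; rewrite kprojE !ttuple_comp //.
by apply: eq_ttuple.
Qed.

(** The universal property with Y = K, and then, after a swap, with Y = X^F. *)
Lemma kproj2_inj B (u v : B ~> K ⊗ K) :
  (forall F G, kproj K F ⊠ kproj K G ∘ u = kproj K F ⊠ kproj K G ∘ v) -> u = v.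
Proof.
move=> uv; apply: kproj_inj => F.
have swapI : injective (comp (@swap C (fpow X F) K) (X := B)).
  by move=> f g /(congr1 (comp swap)); rewrite !compA swapK !comp_idl.
apply: swapI; apply: kproj_inj => G.
have E (w : B ~> K ⊗ K) : kproj K G ⊠ idm _ ∘ (swap ∘ (kproj K F ⊠ idm _ ∘ w))
    = swap ∘ (kproj K F ⊠ kproj K G ∘ w).
  rewrite !compA -swap_nat -!compA; congr (_ ∘ _).
  by rewrite compA -tensm_comp comp_idl comp_idr.
by rewrite !E uv.
Qed.

(** Two copies of f are compared on pairs of finite marginals; both marginals are
    functions of the one on F ∪ G, which is copied by assumption. *)
Lemma det_kproj_comp B (f : B ~> K) :
  (forall F, deterministic (kproj K F ∘ f)) -> deterministic f.
Proof.
move=> df; apply: kproj2_inj => F G.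
rewrite -pairE tens_pair compA copyE tens_pair !comp_idr.
have [sF sG] : F `<=` F `|` G /\ G `<=` F `|` G by rewrite fsubsetUl fsubsetUr.
rewrite (kproj_sub K sF) (kproj_sub K sG).
by rewrite -[in RHS](pair_det _ _ (kproj_det K _)) -!compA -pair_det.
Qed.

Lemma det_treorder i s t (P : perm_eq s (map i t)) : deterministic (treorder X P).
Proof.
elim: t s P => [|x t IHt] s P /=; first det.
by apply: det_comp; [det | exact: det_textract].
Qed.

Section Reindex.
Variables (i : nat -> nat) (inj_i : injective i).

Lemma det_kreindex : deterministic (kreindex K inj_i).
Proof.
apply: det_kproj_comp => F; rewrite ktuple_proj.
by apply: det_comp; [exact: det_treorder | exact: kproj_det].
Qed.

Lemma kcoord_reindex x : kcoord x ∘ kreindex K inj_i = kcoord (i x).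
Proof.
have ixF : i x \in fenum [fset i n | n in [fset x]].
  by rewrite mem_fenum; apply: in_imfset; rewrite inE.
rewrite -compA ktuple_proj compA -(tcoord_kproj ixF); congr (_ ∘ _).
by apply: tcoord_treorder => //; exact: fenum_uniq.
Qed.

Lemma kproj_reindex F : kproj K F ∘ kreindex K inj_i =
  ttuple (size (fenum F)) (fun k => kcoord (i (nth 0 (fenum F) k))).
Proof.
rewrite kprojE ttuple_comp; last exact: det_kreindex.
by apply: eq_ttuple => k _; rewrite kcoord_reindex.
Qed.
End Reindex.

End Powers.

(** * Independent identically distributed sequences are exchangeable *)

Lemma textract_nat X Y (f : X ~> Y) x s (xs : x \in s) :
  textract Y xs ∘ tpowm f (size s) = f ⊠ tpowm f (size (rem x s)) ∘ textract X xs.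
Proof.
elim: s xs => [|y s IHs] //= xs.
move: (@mem_behead x y s); case: (y == x) => b /=.
  by rewrite comp_idl comp_idr.
by rewrite -compA -tensm_comp IHs comp_idl compA -swap_fst_nat -compA -tensm_comp
  comp_idr.
Qed.

Lemma iter_copyS X n : iter_copy X n.+1 = ⟨idm X, iter_copy X n⟩.
Proof. by rewrite pairE. Qed.

Lemma textract_iter_copy X x s (xs : x \in s) :
  textract X xs ∘ iter_copy X (size s) = ⟨idm X, iter_copy X (size (rem x s))⟩.
Proof.
elim: s xs => [|y s IHs] xs; first by [].
rewrite [size _]/= iter_copyS.
apply: (@textract_elim C X x y s xs (fun s0 e => e ∘ ⟨idm X, iter_copy X (size s)⟩ =
  ⟨idm X, iter_copy X (size s0)⟩)).
  by rewrite comp_idl.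
by move=> E; rewrite -compA tens_pair IHs comp_idl swap_fst_pair -iter_copyS.
Qed.

Lemma treorder_nat X Y (f : X ~> Y) i s t (P : perm_eq s (map i t)) :
  treorder Y P ∘ tpowm f (size s) = tpowm f (size t) ∘ treorder X P.
Proof.
elim: t s P => [|x t IHt] s P /=.
  by rewrite [LHS]tunit_terminal [RHS]tunit_terminal.
by rewrite -compA textract_nat !compA -!tensm_comp IHt comp_idl comp_idr.
Qed.

Lemma treorder_iter_copy X i s t (P : perm_eq s (map i t)) :
  treorder X P ∘ iter_copy X (size s) = iter_copy X (size t).
Proof.
elim: t s P => [|x t IHt] s P; first exact: tunit_terminal.
by rewrite iter_copyS /= -compA textract_iter_copy tens_pair IHt comp_idl.
Qed.

Lemma kproj_iid X Y (KX : kolmogorov_power X) (KY : kolmogorov_power Y)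
    (f : X ~> Y) F :
  kproj KY F ∘ (kpowm KX KY f ∘ kcopy KX) = fpowm f F ∘ fcopy X F.
Proof. by rewrite compA ktuple_proj -compA ktuple_proj. Qed.

Lemma exchangeable_iid X Y (KX : kolmogorov_power X) (KY : kolmogorov_power Y)
    (f : X ~> Y) : exchangeable (kpowm KX KY f ∘ kcopy KX).
Proof.
move=> s bij_s _; apply: kproj_ext => F; rewrite compA ktuple_proj -compA !kproj_iid.
by rewrite compA /freorder /fpowm treorder_nat -compA treorder_iter_copy.
Qed.

(** * From finite permutations to the shift *)

Lemma kreindexK X (K : kolmogorov_power X) i j (inj_i : injective i)
    (inj_j : injective j) :
  cancel j i -> kreindex K inj_j ∘ kreindex K inj_i = idm K.
Proof.
move=> ji; apply: kcoord_ext => [||x]; last 1 first.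
- by rewrite compA !kcoord_reindex ji comp_idr.
- by apply: det_comp; exact: det_kreindex.
- det.
Qed.

(** Finite marginals determine f, and on finitely many coordinates the shift acts
    as the finite permutation [cyc n]. *)
Lemma shift_invariant X (K : kolmogorov_power X) B Y (f : B ~> K ⊗ Y) :
  (forall (s : nat -> nat) (bij_s : bijective s),
    (exists F : {fset nat}, forall n, n \notin F -> s n = n) ->
    kreindex K (bij_inj bij_s) ⊠ idm Y ∘ f = f) ->
  kreindex K succn_inj ⊠ idm Y ∘ f = f.
Proof.
move=> inv_f; apply: kproj_inj => F; have [n sF] := sub_initial F.
have fin : exists F : {fset nat}, forall k, k \notin F -> cyc n k = k.
  exists (initial n.+1) => k; rewrite mem_initial ltnS -ltnNge /cyc => nk.
  by rewrite ltnNge ltnW // gtn_eqF.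
rewrite -[in RHS](inv_f _ (bij_cyc n) fin) !compA -!tensm_comp !kproj_reindex.
congr (_ ⊠ _ ∘ _); apply: eq_ttuple => k kF; rewrite /cyc ifT //.
by rewrite -mem_initial (fsubsetP sF) // -mem_fenum mem_nth.
Qed.

(** * Splitting off heads of a stationary random state *)

(** Here m is the law of a random state in W, whose time evolution T has
    [h 0], [h 1], ... as successive observations, and a recovers the
    parameter.  [cond_T] says that f ∘ d is a conditional of the first
    observation given the future, [inv_T] that the value of d does not
    change, in joint law, when the state moves on. *)
Section Stationary.
Variables (A W X D : C) (m : A ~> W) (a : W ~> A) (T : W ~> W) (d : W ~> D).
Variables (f : D ~> X) (h : nat -> W ~> X).
Hypotheses (am : ⟨idm W, a⟩ ∘ m = ⟨m, idm A⟩) (da : deterministic a).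
Hypotheses (dT : deterministic T) (dd : deterministic d) (dh : forall k, deterministic (h k)).
Hypotheses (aT : a ∘ T = a) (hT : forall k, h k ∘ T = h k.+1).
Hypothesis cond_T : ⟨T, h 0⟩ ∘ m = ⟨idm W, f ∘ d⟩ ∘ m.
Hypothesis inv_T : ⟨T, d⟩ ∘ m = ⟨idm W, d⟩ ∘ m.

(** Conditioning [h 0] on (T, d) rather than on T gives nothing new: (T, d) has
    the law of (id, d), in which the second component is a function of the first.
    So the conditional c on W ⊗ D restricts along ⟨id, d⟩ to a conditional on
    W, which [cond_T] identifies. *)
Lemma cond_stationary : ⟨⟨T, d⟩, h 0⟩ ∘ m = ⟨⟨idm W, d⟩, f ∘ d⟩ ∘ m.
Proof.
have du : deterministic ⟨T, d⟩ by det.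
have wu : a ∘ pfst W D ∘ ⟨T, d⟩ = a by rewrite -compA pfst_pair aT.
have [c cP] := conditional_exists (h 0) am du (det_comp da (det_pfst W D)) wu.
(* The right-hand side is the graph of c over the law of ⟨T, d⟩, which is that of
   ⟨idm W, d⟩. *)
have E : ⟨⟨T, d⟩, h 0⟩ ∘ m = ⟨⟨idm W, d⟩, c ∘ ⟨idm W, d⟩⟩ ∘ m.
  rewrite cP -{1}[⟨T, d⟩]comp_idl -(pair_det _ _ du) -compA inv_T compA.
  by rewrite pair_det ?comp_idl //; det.
have E' : ⟨idm W, f ∘ d⟩ ∘ m = ⟨idm W, c ∘ ⟨idm W, d⟩⟩ ∘ m.
  have := congr1 (comp (pfst W D ⊠ idm X)) E.
  by rewrite !compA !tens_pair !pfst_pair !comp_idl cond_T.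
have := congr1 (comp (⟨idm W, d⟩ ⊠ idm X)) E'.
by rewrite !compA !tens_pair !comp_idr !comp_idl E => ->.
Qed.

(** By induction: by [cond_stationary], the first observation together with
    the n following ones and d has the law of a sample from f ∘ d together with
    the first n observations and d. *)
Lemma iid_stationary n :
  ⟨ttuple n h, d⟩ ∘ m = ⟨tpowm f n ∘ iter_copy D n, idm D⟩ ∘ d ∘ m.
Proof.
elim: n => [|n IHn].
  have -> : tpowm f 0 ∘ iter_copy D 0 = del D by exact: tunit_terminal.
  by rewrite (pair_det _ _ dd) comp_idl del_nat.
have dr : deterministic (ttuple n h) by exact: det_ttuple.
have -> : ttuple n.+1 h = ⟨h 0, ttuple n h ∘ T⟩.
  by rewrite ttuple_comp //=; congr (⟨_, _⟩); apply: eq_ttuple => k _.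
have -> : ⟨⟨h 0, ttuple n h ∘ T⟩, d⟩ =
    associ ∘ swap ∘ (ttuple n h ⊠ idm D) ⊠ idm X ∘ ⟨⟨T, d⟩, h 0⟩.
  by rewrite -!compA !tens_pair !comp_idl swap_pair associ_pair.
rewrite -(compA _ ⟨_, _⟩) cond_stationary compA.
have -> : associ ∘ swap ∘ (ttuple n h ⊠ idm D) ⊠ idm X ∘ ⟨⟨idm W, d⟩, f ∘ d⟩
        = associ ∘ swap ∘ associ ∘ idm _ ⊠ ⟨idm D, f⟩ ∘ ⟨ttuple n h, d⟩.
  by rewrite -!compA !tens_pair pair_det // !comp_idl comp_idr associ_pair.
have -> : tpowm f n.+1 ∘ iter_copy D n.+1 = ⟨f, tpowm f n ∘ iter_copy D n⟩.
  by rewrite iter_copyS /= tens_pair comp_idr.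
rewrite -(compA _ ⟨_, _⟩) IHn !compA; congr (_ ∘ _ ∘ _).
by rewrite -!compA tens_pair comp_idl comp_idr associ_pair swap_pair associ_pair.
Qed.

End Stationary.

(** * Exchangeable sequences *)

Lemma as_eqE T A X (m : T ~> A) (f g : A ~> X) :
  as_eq m f g <-> ⟨idm A, f⟩ ∘ m = ⟨idm A, g⟩ ∘ m.
Proof. by rewrite !pairE. Qed.

(** Moving a state by S and reading off f afterwards is the same as starting from
    the moved state, whose law is again m. *)
Lemma graph_pushforward A W X (m : A ~> W) (S : W ~> W) (f : W ~> X) :
  deterministic S -> S ∘ m = m ->
  S ⊠ idm X ∘ (⟨idm W, f ∘ S⟩ ∘ m) = ⟨idm W, f⟩ ∘ m.
Proof.
move=> dS Sm; rewrite -[in RHS]Sm !compA tens_pair comp_idr comp_idl.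
by rewrite (pair_det _ _ dS) comp_idl.
Qed.

Section Representability.
Variables (P : representable C) (P_as : as_compatible P).

(** Almost sure equality with respect to the identity is equality, so [P_as]
    reflects equality of morphisms. *)
Lemma sharp_inj A X (f g : A ~> X) : sharp (P X) f = sharp (P X) g -> f = g.
Proof.
move=> fg; have /as_eqE : as_eq (idm A) f g by apply/P_as; rewrite fg.
by rewrite !comp_idr => /(congr1 (comp (psnd A X))); rewrite !psnd_pair.
Qed.

Lemma samp_sharp A X (f : A ~> X) : samp P X ∘ sharp (P X) f = f.
Proof.
apply: sharp_inj; rewrite sharp_nat; last exact: sharp_det.
by rewrite /samp unsharpK comp_idl.
Qed.

Section Exchangeable.
Variables (A X : C) (K : kolmogorov_power X) (p : A ~> K).
Hypothesis exch_p : exchangeable p.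

(** The sequence together with the parameter it depends on. *)
Let m : A ~> K ⊗ A := ⟨p, idm A⟩.
Let T : K ⊗ A ~> K ⊗ A := kreindex K succn_inj ⊠ idm A.
Let h k : K ⊗ A ~> X := kcoord K k ∘ pfst K A.
Let R i (inj_i : injective i) : K ⊗ A ~> K ⊗ A := kreindex K inj_i ⊠ idm A.

Let finitary (s : nat -> nat) :=
  exists F : {fset nat}, forall n, n \notin F -> s n = n.

Lemma det_R i (inj_i : injective i) : deterministic (R inj_i).
Proof. by apply: det_tens; [exact: det_kreindex | det]. Qed.

Lemma h_R i (inj_i : injective i) k : h k ∘ R inj_i = h (i k).
Proof. by rewrite /h /R -compA pfst_nat compA kcoord_reindex. Qed.

Lemma perm_exchangeable s (bij_s : bijective s) :
  finitary s -> R (bij_inj bij_s) ∘ m = m.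
Proof. by move=> fin; rewrite tens_pair exch_p ?comp_idl. Qed.

Lemma shift_exchangeable : T ∘ m = m.
Proof. by apply: shift_invariant => s bij_s; exact: perm_exchangeable. Qed.

(** After applying s to the sequence, both sides become the law of
    (permuted tail, head) for p: the left one by exchangeability of p under s,
    the right one by exchangeability under the lift of s to the tail.
    Since s is invertible, it can be cancelled. *)
Lemma head_conditional_perm s (bij_s : bijective s) (psi : K ⊗ A ~> X) :
  ⟨T, h 0⟩ ∘ m = ⟨idm _, psi⟩ ∘ m -> finitary s ->
  ⟨idm _, psi ∘ R (bij_inj bij_s)⟩ ∘ m = ⟨idm _, psi⟩ ∘ m.
Proof.
move=> psiP fin; set S := R _.
have dS : deterministic S by exact: det_R.
have [r sr rs] := bij_s; pose S' := R (can_inj rs).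
have S'S : S' ∘ S = idm _.
  by rewrite /S' /S /R -tensm_comp kreindexK // comp_idl tensm_id.
have cancelS (u v : A ~> (K ⊗ A) ⊗ X) : S ⊠ idm X ∘ u = S ⊠ idm X ∘ v -> u = v.
  move/(congr1 (comp (S' ⊠ idm X))).
  by rewrite !compA -tensm_comp S'S comp_idl tensm_id !comp_idl.
apply: cancelS; rewrite graph_pushforward //; last exact: perm_exchangeable.
rewrite -psiP; set L := R (bij_inj (bij_lift_perm bij_s)).
have Lm : L ∘ m = m.
  apply: perm_exchangeable; have [F FP] := fin.
  exists (0 |` [fset k.+1 | k in F]) => -[|k] /=; first by rewrite !inE.
  rewrite !inE /= => kF; congr _.+1; apply: FP.
  by apply: contra kF => kF; apply/imfsetP; exists k.
have TL : T ∘ L = S ∘ T.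
  rewrite -!tensm_comp; congr (_ ⊠ _).
  apply: kcoord_ext => [||x]; try by apply: det_comp; exact: det_kreindex.
  by rewrite [LHS]compA [RHS]compA !kcoord_reindex.
rewrite -[in LHS]Lm compA (pair_det _ _ (det_R _)) TL h_R /=.
by rewrite compA tens_pair comp_idl.
Qed.

Lemma head_sharp_perm s (bij_s : bijective s) (psi : K ⊗ A ~> X)
    (d := sharp (P X) psi) :
  ⟨T, h 0⟩ ∘ m = ⟨idm _, psi⟩ ∘ m -> finitary s ->
  R (bij_inj bij_s) ⊠ idm _ ∘ (⟨idm _, d⟩ ∘ m) = ⟨idm _, d⟩ ∘ m.
Proof.
move=> psiP fin.
have /as_eqE/P_as/as_eqE := head_conditional_perm bij_s psiP fin.
rewrite sharp_nat; last exact: det_R.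
move=> e; rewrite -[in LHS]e; apply: graph_pushforward; first exact: det_R.
exact: perm_exchangeable.
Qed.

Lemma head_sharp_shift (psi : K ⊗ A ~> X) (d := sharp (P X) psi) :
  ⟨T, h 0⟩ ∘ m = ⟨idm _, psi⟩ ∘ m -> ⟨T, d⟩ ∘ m = ⟨idm _, d⟩ ∘ m.
Proof.
move=> psiP.
(* Rebracketing exposes the sequence as the first factor, the others being
   the parameter and d. *)
have assocI : injective (comp (@assoc C K A (P X)) (X := A)).
  by move=> u v /(congr1 (comp associ)); rewrite !compA assocK !comp_idl.
apply: assocI.
have -> : ⟨T, d⟩ = T ⊠ idm _ ∘ ⟨idm _, d⟩ by rewrite tens_pair comp_idr comp_idl.
rewrite -[Z in _ ∘ Z]compA [LHS]compA assoc_nat tensm_id -[LHS]compA.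
apply: shift_invariant => s bij_s fin.
by rewrite compA -tensm_id -assoc_nat -compA head_sharp_perm.
Qed.

Lemma exchangeable_iid_mixture (KP : kolmogorov_power (P X)) :
  exists mu : A ~> P X, p = kpowm KP K (samp P X) ∘ kcopy KP ∘ mu.
Proof.
have dT : deterministic T by exact: det_R.
have dh k : deterministic (h k) by apply: det_comp; [exact: det_kcoord | det].
have hT k : h k ∘ T = h k.+1 by exact: h_R.
have am : ⟨idm (K ⊗ A), psnd K A⟩ ∘ m = ⟨m, idm A⟩ by rewrite pair_graph comp_idl.
have aT : psnd K A ∘ T = psnd K A by rewrite psnd_nat comp_idl.
have [psi psiP] := conditional_exists (h 0) am dT (det_psnd K A) aT.
(* The tail has the same law as the whole sequence. *)
have {}psiP : ⟨T, h 0⟩ ∘ m = ⟨idm _, psi⟩ ∘ m.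
  by rewrite psiP -{1}[T]comp_idl -pair_det // -compA shift_exchangeable.
pose d := sharp (P X) psi.
have dd : deterministic d by exact: sharp_det.
have cond_T : ⟨T, h 0⟩ ∘ m = ⟨idm _, samp P X ∘ d⟩ ∘ m by rewrite samp_sharp.
exists (d ∘ m); apply: kproj_ext_initial => n.
rewrite compA kproj_iid kproj_initial.
have := iid_stationary am (det_psnd K A) dT dd dh aT hT cond_T
  (head_sharp_shift psiP) (size (fenum (initial n))).
move/(congr1 (comp (pfst _ _))); rewrite !compA !pfst_pair => <-.
rewrite -ttuple_comp; last det.
by rewrite -compA pfst_pair.
Qed.

End Exchangeable.
End Representability.
End MarkovCategory.

Theorem theorem4p4 (C : markov_category)
    (conds : has_conditionals C)
    (P : representable C) (P_as : as_compatible P)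
    (K : kolmogorov_powers C)
    (A X : C) (p : A ~> K X) :
  exchangeable p <->
  exists mu : A ~> P X,
    p = kpowm (K (P X)) (K X) (samp P X) ∘ kcopy (K (P X)) ∘ mu.
Proof.
split=> [exch_p | [mu ->] s bij_s fin].
  exact: exchangeable_iid_mixture.
by rewrite compA exchangeable_iid.
Qed.
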